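(* Fix $p\ge2$, $\beta>0$ and a sequence of $p$-tensors $\{\bm J_N\}_{N\ge1}$ (symmetric, with zero diagonals) such that (1) $\sup_{N\ge1}\mathbb E_\beta[\|\bm J_N(\bm Z)\|^4]<\infty$, where the expectation is over $\bm Z\sim\mathbb P_\beta$ and $\|\cdot\|$ is the operator norm; and (2) $\liminf_{N\to\infty}\frac1NF_N(\beta)>0$. Then, given a single sample $\bm X\sim\mathbb P_\beta$, the MPL estimate $\hat\beta_N(\bm X)$ is $\sqrt N$-consistent for $\beta$: for every $\delta>0$ there is $M=M(\delta,\beta)>0$ with $\mathbb P_\beta(\sqrt N|\hat\beta_N(\bm X)-\beta|\le M)>1-\delta$ for all $N$ large enough.
   Context: $p$-tensor Ising model: given a $p$-tensor $\bm J_N=((J_{i_1\dots i_p}))_{1\le i_1,\dots,i_p\le N}$ that is symmetric under permutations of indices and satisfies $J_{i_1\dots i_p}=0$ whenever two indices coincide, and $\beta\ge0$, $\mathbb P_\beta(\bm X)=\frac{1}{2^NZ_N(\beta)}e^{\beta H_N(\bm X)}$ on $\{-1,1\}^N$, with $H_N(\bm X)=\sum_{1\le i_1,\dots,i_p\le N}J_{i_1\dots i_p}X_{i_1}\cdots X_{i_p}$, $Z_N(\beta)=2^{-N}\sum_{\bm X}e^{\beta H_N(\bm X)}$, $F_N(\beta)=\log Z_N(\beta)$. Let $m_i(\bm X)=\sum_{i_2,\dots,i_p}J_{ii_2\dots i_p}X_{i_2}\cdots X_{i_p}$. The MPL estimate is $\hat\beta_N(\bm X)=\inf\{b\ge0:H_N(\bm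 X)=\sum_{i=1}^Nm_i(\bm X)\tanh(pb\,m_i(\bm X))\}$ (infimum of the empty set $=+\infty$). The local interaction matrix at $\bm x\in\{-1,1\}^N$ is the $N\times N$ matrix $\bm J_N(\bm x)$ with entries $J_{i_1i_2}(\bm x)=\sum_{i_3,\dots,i_p}J_{i_1i_2i_3\dots i_p}x_{i_3}\cdots x_{i_p}$ (for $p=2$, $\bm J_N(\bm x)=\bm J_N$). *)

(* Defs.v *)
From HB Require Import structures.
From mathcomp Require Import all_boot all_order all_algebra.
From mathcomp Require Import all_classical all_reals all_analysis.
Set Implicit Arguments. Unset Strict Implicit. Unset Printing Implicit Defensive.
Import Order.TTheory GRing.Theory Num.Theory.
Local Open Scope ring_scope.
Local Open Scope classical_set_scope.

Section Ising.
Variable R : realType.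

(* A p-tensor on 'I_N, indexed by sequences of indices; only sequences of
   length p are ever used. *)
Definition tensor (N : nat) := seq 'I_N -> R.

Definition tensor_symmetric (p N : nat) (J : tensor N) : Prop :=
  forall s t : seq 'I_N, size s = p -> perm_eq s t -> J s = J t.

Definition tensor_zero_diag (p N : nat) (J : tensor N) : Prop :=
  forall s : seq 'I_N, size s = p -> ~~ uniq s -> J s = 0.

Definition config (N : nat) := {ffun 'I_N -> bool}.
Definition spin N (x : config N) (i : 'I_N) : R := if x i then 1 else -1.

Definition prod_spins N (x : config N) (s : seq 'I_N) : R :=
  \prod_(j <- s) spin x j.

Definition Ham (p N : nat) (J : tensor N) (x : config N) : R :=
  \sum_(t : p.-tuple 'I_N) J (tval t) * prod_spins x (tval t).

Definition mloc (p N : nat) (J : tensor N) (x : config N) (i : 'I_N) : R :=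
  \sum_(t : p.-1.-tuple 'I_N) J (i :: tval t) * prod_spins x (tval t).

Definition Jloc (p N : nat) (J : tensor N) (x : config N) : 'M[R]_N :=
  \matrix_(i1, i2) \sum_(t : (p - 2).-tuple 'I_N)
     J (i1 :: i2 :: tval t) * prod_spins x (tval t).

Definition Zpart (p N : nat) (J : tensor N) (beta : R) : R :=
  (2 ^+ N)^-1 * \sum_(x : config N) expR (beta * Ham p J x).

Definition Fpart (p N : nat) (J : tensor N) (beta : R) : R :=
  ln (Zpart p J beta).

Definition Pbeta (p N : nat) (J : tensor N) (beta : R) (x : config N) : R :=
  expR (beta * Ham p J x) / (2 ^+ N * Zpart p J beta).

Definition Prob (p N : nat) (J : tensor N) (beta : R) (A : config N -> Prop) : R :=
  \sum_(x : config N | `[< A x >]) Pbeta p J beta x.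

Definition Expect (p N : nat) (J : tensor N) (beta : R) (f : config N -> R) : R :=
  \sum_(x : config N) Pbeta p J beta x * f x.

Definition vnorm N (v : 'cV[R]_N) : R := Num.sqrt (\sum_i v i 0 ^+ 2).

Definition opnorm N (A : 'M[R]_N) : R :=
  sup [set vnorm (A *m v) | v in [set v : 'cV[R]_N | vnorm v = 1]].

Definition tanh (x : R) : R := (expR x - expR (- x)) / (expR x + expR (- x)).

(* MPL estimate, valued in the extended reals (inf of empty set = +oo) *)
Definition mple (p N : nat) (J : tensor N) (x : config N) : \bar R :=
  ereal_inf [set (b%:E) | b in
    [set b : R | 0 <= b /\
       Ham p J x = \sum_i mloc p J x i * tanh (p%:R * b * mloc p J x i)]].

End Ising.

(* Main.v *)
Require Import Defs.
From HB Require Import structures.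
From mathcomp Require Import all_boot all_order all_algebra.
From mathcomp Require Import all_classical all_reals all_analysis.
From mathcomp Require Import ring lra.
Import Order.TTheory GRing.Theory Num.Theory.
Import numFieldNormedType.Exports.
Local Open Scope ring_scope.
Local Open Scope classical_set_scope.
Set Implicit Arguments. Unset Strict Implicit. Unset Printing Implicit Defensive.

(**
  Write m_i for the local fields, g(b) = sum_i m_i tanh(p b m_i), and
  S = H - g(beta) = sum_i m_i (x_i - tanh(p beta m_i)), so that the estimator solves
  g(b) = H and its error is controlled by S divided by the slope of g.

  Size of S: given the other spins, x_i has mean tanh(p beta m_i), hence
  E[S^2] = E[sum_i m_i (x_i - tanh(p beta m_i)) S] turns into the expected effect on S
  of flipping x_i.  A flip changes m_j by 2 (p-1) x_i J_ji(x), and a second-order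
  Taylor expansion of m tanh(p beta m) leaves the bilinear form of J(x) between a
  vector of size O(|m_i|) and a bounded vector, plus a remainder controlled by the
  column norms of J(x); as m = J(x) x, this gives E[S^2] = O(N E[1 + |J(x)|^4]).

  Slope of g: P(H < e N) <= exp(beta e N - F_N) is small for small e.  When H >= e N,
  sum_i |m_i| >= e N while sum_i m_i^2 <= |J(x)|^2 N, so a positive proportion of
  sum_i m_i^2 comes from bounded m_i, and g has slope of order N on [0, beta + 1].
*)

(** * Calculus of tanh t and of t tanh t *)

Section Tanh.
Variable R : realType.
Implicit Types a b c t u v : R.

Lemma expRDN_gt0 t : 0 < expR t + expR (- t).
Proof. by rewrite addr_gt0 ?expR_gt0. Qed.

Lemma tanhN t : tanh (- t) = - tanh t.
Proof. by rewrite /tanh opprK [in LHS]addrC -mulNr opprB [expR (- t) + _]addrC addrC. Qed.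

Lemma tanh0 : tanh 0 = 0 :> R.
Proof. by rewrite /tanh oppr0 subrr mul0r. Qed.

Lemma tanhB a b :
  tanh a - tanh b = 2 * (expR (a - b) - expR (b - a)) /
    ((expR a + expR (- a)) * (expR b + expR (- b))).
Proof.
have Ha := lt0r_neq0 (expRDN_gt0 a); have Hb := lt0r_neq0 (expRDN_gt0 b).
rewrite /tanh !expRD; field.
by apply/andP.
Qed.

Lemma one_sub_tanh_sqr t : 1 - tanh t ^+ 2 = 4 / (expR t + expR (- t)) ^+ 2.
Proof.
have Ha := lt0r_neq0 (expRDN_gt0 t).
have E : expR t * expR (- t) = 1 :> R by rewrite -expRD subrr expR0.
have -> : 4 = 4 * (expR t * expR (- t)) :> R by rewrite E mulr1.
by rewrite /tanh; field.
Qed.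

Lemma norm_tanh_lt1 t : `|tanh t| < 1.
Proof.
rewrite -[X in _ < X]normr1 -ltr_sqr ?nnegrE// !real_normK ?num_real//.
rewrite -subr_gt0 expr1n one_sub_tanh_sqr.
by rewrite divr_gt0 ?exprn_gt0// expRDN_gt0.
Qed.

Lemma expR_normD t : 1 + `|t| <= expR t + expR (- t).
Proof.
have [t0|t0] := leP 0 t.
  by rewrite ger0_norm// (le_trans (expR_ge1Dx _))// lerDl expR_ge0.
by rewrite ltr0_norm// (le_trans (expR_ge1Dx _))// lerDr expR_ge0.
Qed.

(** As 1 - tanh^2 is 4 / (e^t + e^-t)^2 and the denominator is at least (1 + |t|)^2, this reduces to
    (1 - |t|)^2 >= 0. *)
Lemma norm_mul_sech_sqr_le1 t : `|t| * (1 - tanh t ^+ 2) <= 1.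
Proof.
have Ha := expRDN_gt0 t.
rewrite one_sub_tanh_sqr mulrA ler_pdivrMr ?exprn_gt0// mul1r.
have H := expR_normD t; have H0 := normr_ge0 t.
apply: (@le_trans _ _ ((1 + `|t|) ^+ 2)).
  by rewrite -subr_ge0 (_ : _ - _ = (1 - `|t|) ^+ 2) ?sqr_ge0//; ring.
by rewrite ler_sqr ?nnegrE// ?addr_ge0// ltW.
Qed.

Lemma is_derive_tanh t : is_derive t 1 (@tanh R) (1 - tanh t ^+ 2).
Proof.
have Ha := lt0r_neq0 (expRDN_gt0 t).
have Hd : is_derive t 1 (fun x : R => expR (- x)) (- expR (- t)).
  by apply: is_derive_eq; rewrite -[LHS]/(_ * _) mulrN1.
rewrite /tanh.
apply: is_derive_eq.
rewrite /GRing.scale /=; field.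
by [].
Qed.

(** Mean value theorem without an order on the endpoints; the bound on [c] turns a Lipschitz
    derivative into a quadratic Taylor remainder. *)
Lemma MVT_norm (f df : R -> R) a b :
  (forall x : R, is_derive x 1 f (df x)) ->
  exists2 c, `|c - a| <= `|b - a| & f b - f a = df c * (b - a).
Proof.
move=> Hf.
have Hc A : {within A, continuous f}.
  apply: continuous_subspaceT => x; apply: differentiable_continuous.
  by apply/derivable1_diffP; case: (Hf x).
have [ab|/ltW ba] := leP a b.
  have [c] := MVT_segment ab (fun x _ => Hf x) (Hc _).
  rewrite in_itv /= => /andP[ac cb] E; exists c => //.
  by rewrite !ger0_norm ?subr_ge0// lerD2r.
have [c] := MVT_segment ba (fun x _ => Hf x) (Hc _).
rewrite in_itv /= => /andP[bc ca] E; exists c.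
  by rewrite !ler0_norm ?subr_le0// lerN2 lerD2r.
by rewrite -opprB E -mulrN opprB.
Qed.

(** Derivative of t tanh t. *)
Definition dxtanh t := tanh t + t * (1 - tanh t ^+ 2).

Lemma norm_dxtanh t : `|dxtanh t| <= 2.
Proof.
rewrite /dxtanh (le_trans (ler_normD _ _))// (_ : 2 = 1 + 1 :> R); last by ring.
apply: lerD; first exact/ltW/norm_tanh_lt1.
rewrite normrM [X in _ * X]ger0_norm ?norm_mul_sech_sqr_le1//.
by rewrite one_sub_tanh_sqr divr_ge0// sqr_ge0.
Qed.

(** Both summands of the derivative [d] are at most 2 in absolute value. *)
Lemma dxtanh_lipschitz a b : `|dxtanh b - dxtanh a| <= 4 * `|b - a|.
Proof.
pose d t := 2 * (1 - tanh t ^+ 2) - 2 * tanh t * (t * (1 - tanh t ^+ 2)).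
have Hd t : is_derive t 1 dxtanh (d t).
  have Ht := is_derive_tanh t.
  rewrite /dxtanh /d; apply: is_derive_eq.
  rewrite /GRing.scale /=. ring.
have [c _ ->] := MVT_norm a b Hd.
rewrite normrM ler_wpM2r// /d.
have H1 := norm_tanh_lt1 c; have H2 := norm_mul_sech_sqr_le1 c.
have Hs : 0 <= 1 - tanh c ^+ 2.
  by rewrite one_sub_tanh_sqr divr_ge0// sqr_ge0.
rewrite (le_trans (ler_normB _ _))// (_ : 4 = 2 + 2 :> R); last by ring.
apply: lerD.
  by rewrite ger0_norm ?mulr_ge0// ler_piMr// gerBl sqr_ge0.
rewrite -mulrA normrM (ger0_norm (ler0n _ 2)) ler_piMr// normrM.
by rewrite mulr_ile1// ?(ltW H1)// normrM (ger0_norm Hs).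
Qed.

Lemma xtanh_taylor a b :
  `|b * tanh b - a * tanh a - dxtanh a * (b - a)| <= 4 * (b - a) ^+ 2.
Proof.
have Hd t : is_derive t 1 (fun x => x * tanh x) (dxtanh t).
  have Ht := is_derive_tanh t.
  rewrite /dxtanh; apply: is_derive_eq; rewrite /GRing.scale /=; ring.
have [c Hc ->] := MVT_norm a b Hd.
rewrite -mulrBl normrM -[X in _ <= 4 * X]real_normK ?num_real// expr2 mulrA.
rewrite ler_wpM2r// (le_trans (dxtanh_lipschitz _ _))//.
by rewrite ler_wpM2l.
Qed.

Lemma mul_tanh_scaled_taylor k u v : 0 < k ->
  `|v * tanh (k * v) - u * tanh (k * u) - dxtanh (k * u) * (v - u)|
    <= 4 * k * (v - u) ^+ 2.
Proof.
move=> k0; rewrite -(ler_pM2l k0) -{1}(gtr0_norm k0) -normrM.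
have := xtanh_taylor (k * u) (k * v).
by congr (`|_| <= _); ring.
Qed.

(** For t >= 0 and s = (b - a) t, [tanhB] has numerator at least 2 s and denominator at most 4 e^(2
    b t). The exponential loss is harmless once |t| is bounded. *)
Lemma tanh_strong_mono t a b : 0 <= a <= b ->
  (b - a) * t ^+ 2 * expR (- (2 * (b * `|t|))) / 2 <= t * (tanh (b * t) - tanh (a * t)).
Proof.
move=> /andP[a0 ab].
(* Both sides are even in [t]. *)
wlog t0 : t / 0 <= t => [W|].
  have [/W//|/ltW t0] := leP 0 t.
  have := W (- t); rewrite oppr_ge0 normrN !mulrN !tanhN sqrrN => /(_ t0).
  by congr (_ <= _); ring.
rewrite (ger0_norm t0) tanhB.
have b0 := le_trans a0 ab.
have L s : 0 <= s <= b * t -> expR s + expR (- s) <= 2 * expR (b * t).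
  move=> /andP[s0 sb]; rewrite mulr_natl mulr2n lerD// ler_expR//.
  by rewrite (le_trans _ sb)// (le_trans _ s0)// oppr_le0.
have La : expR (a * t) + expR (- (a * t)) <= 2 * expR (b * t).
  by apply: L; rewrite mulr_ge0// ler_wpM2r.
have Lb : expR (b * t) + expR (- (b * t)) <= 2 * expR (b * t).
  by apply: L; rewrite mulr_ge0//=.
rewrite (_ : _ / 2 = t * ((b - a) * t * expR (- (2 * (b * t))) / 2)); last by ring.
rewrite ler_wpM2l//.
set s := (b - a) * t.
have s0 : 0 <= s by rewrite mulr_ge0// subr_ge0.
have E : s <= expR (b * t - a * t) - expR (a * t - b * t).
  have -> : b * t - a * t = s by rewrite /s; ring.
  have -> : a * t - b * t = - s by rewrite /s; ring.
  have H1 := expR_ge1Dx s; have H2 := expR_gt0 (- s).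
  have H3 : expR s * expR (- s) = 1 :> R by rewrite -expRD subrr expR0.
  have H4 : expR (- s) <= 1 by rewrite -H3 ler_peMl ?expR_ge0//; lra.
  lra.
have D : (expR (b * t) + expR (- (b * t))) * (expR (a * t) + expR (- (a * t)))
    <= 4 * expR (2 * (b * t)).
  rewrite (_ : 4 * _ = 2 * expR (b * t) * (2 * expR (b * t))).
    by apply: ler_pM => //; exact/ltW/expRDN_gt0.
  by rewrite (mulr_natl (b * t)) mulr2n expRD; ring.
rewrite expRN.
have G := expR_gt0 (2 * (b * t)).
rewrite ler_pdivlMr ?mulr_gt0 ?expRDN_gt0//.
rewrite [X in X <= _](_ : _ = s / 2 / expR (2 * (b * t)) *
  ((expR (b * t) + expR (- (b * t))) * (expR (a * t) + expR (- (a * t))))); last by ring.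
apply: le_trans (_ : s / 2 / expR (2 * (b * t)) * (4 * expR (2 * (b * t))) <= _).
  by apply: ler_wpM2l D; rewrite !divr_ge0// ltW.
rewrite (_ : s / 2 / _ * _ = 2 * s); last by field; rewrite lt0r_neq0.
by rewrite ler_wpM2l.
Qed.

End Tanh.

(** * Multilinear forms of a tensor and their change under a spin flip *)

Section Forms.
Variables (R : realType) (N : nat).
Implicit Types (x : config N) (i j k : 'I_N) (K : tensor R N).

Definition flip i x : config N := [ffun k => if k == i then ~~ x k else x k].

Lemma flipK i : involutive (flip i).
Proof. by move=> x; apply/ffunP => k; rewrite !ffunE; case: eqP => //; rewrite negbK. Qed.

Lemma spin_flip i x k :
  spin R (flip i x) k = if k == i then - spin R x k else spin R x k.
Proof. by rewrite /spin ffunE; case: eqP => // _; case: (x k); rewrite ?opprK. Qed.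

Lemma spin_sqr x i : spin R x i * spin R x i = 1.
Proof. by rewrite /spin; case: (x i); rewrite ?mulrNN mulr1. Qed.

Lemma norm_spin x i : `|spin R x i| = 1.
Proof. by rewrite /spin; case: (x i); rewrite ?normrN normr1. Qed.

(** Slice of the tensor at a fixed first index. Local fields and local interactions are [Ham] of
    slices, which allows induction on the order. *)
Definition tcons (i : 'I_N) K : tensor R N := fun s => K (i :: s).

Lemma tcons_symmetric q i K :
  tensor_symmetric q.+1 K -> tensor_symmetric q (tcons i K).
Proof. by move=> HK s t Hs Hst; apply: HK; rewrite /= ?Hs ?perm_cons. Qed.

Lemma tcons_zero_diag q i K :
  tensor_zero_diag q.+1 K -> tensor_zero_diag q (tcons i K).
Proof. by move=> HK s Hs Hu; apply: HK; rewrite /= ?Hs ?negb_and ?Hu ?orbT. Qed.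

Lemma Ham0 K x : Ham 0 K x = K [::].
Proof.
rewrite /Ham (big_pred1 [tuple]) => [|t]; last by rewrite [t]tuple0 /=; apply/esym/eqP.
by rewrite /prod_spins big_nil mulr1.
Qed.

Lemma Ham_cons q K x : Ham q.+1 K x = \sum_i spin R x i * Ham q (tcons i K) x.
Proof.
rewrite /Ham (reindex (fun u : 'I_N * q.-tuple 'I_N => [tuple of u.1 :: u.2])) /=; last first.
  exists (fun t : q.+1.-tuple 'I_N => (thead t, [tuple of behead t])).
    by move=> [i t] _ /=; congr pair; apply/val_inj.
  by move=> t _ /=; rewrite [RHS]tuple_eta; apply/val_inj.
rewrite (eq_bigr (fun u => (fun i (t : q.-tuple 'I_N) => spin R x i *
   (tcons i K t * prod_spins R x t)) u.1 u.2)); last first.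
  by move=> [i t] _ /=; rewrite /prod_spins big_cons /tcons mulrCA.
rewrite -(pair_bigA _ (fun i (t : q.-tuple 'I_N) => spin R x i *
   (tcons i K t * prod_spins R x t))) /=.
by apply: eq_bigr => i _; rewrite mulr_sumr.
Qed.

Lemma eq_Ham q K K' x : (forall s, size s = q -> K s = K' s) -> Ham q K x = Ham q K' x.
Proof. by move=> E; apply: eq_bigr => t _; rewrite E ?size_tuple. Qed.

Lemma tcons2_eq0 q i K (s : seq 'I_N) : tensor_zero_diag q.+2 K -> size s = q ->
  tcons i (tcons i K) s = 0.
Proof. by move=> HK Hs; apply: HK; rewrite /= ?Hs ?inE ?eqxx. Qed.

Lemma Ham_tcons2 q i K x : tensor_zero_diag q.+2 K -> Ham q (tcons i (tcons i K)) x = 0.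
Proof.
move=> HK; rewrite /Ham big1// => t _.
by rewrite (tcons2_eq0 i HK) ?mul0r// size_tuple.
Qed.

(* For q = 0 both sides vanish thanks to the factor q%:R. *)
Lemma Ham_flip q K i x : tensor_symmetric q K -> tensor_zero_diag q K ->
  Ham q K x - Ham q K (flip i x) = 2 * q%:R * spin R x i * Ham q.-1 (tcons i K) x.
Proof.
elim: q K => [|q IH] K Ks Kz; first by rewrite !Ham0 subrr mulr0 !mul0r.
have step k := IH _ (tcons_symmetric k Ks) (tcons_zero_diag k Kz).
(* The slice at [i] vanishes on sequences containing [i] again, so it does not see the flip. *)
have inv : Ham q (tcons i K) (flip i x) = Ham q (tcons i K) x.
  apply/esym/eqP; rewrite -subr_eq0 step.
  by case: q Kz {IH Ks step} => [|q] Kz; rewrite ?mulr0 ?mul0r// Ham_tcons2// mulr0.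
have sw k : spin R x k * (Ham q (tcons k K) x - Ham q (tcons k K) (flip i x)) =
    2 * q%:R * spin R x i * (spin R x k * Ham q.-1 (tcons i (tcons k K)) x).
  by rewrite step; ring.
(* By symmetry the two slicing indices commute, so the sum over [k] rebuilds the slice at [i]. The q
   = 0 branch is a placeholder that the factor q kills. *)
have sumE : \sum_k spin R x k * Ham q.-1 (tcons i (tcons k K)) x =
    if q is 0 then \sum_k spin R x k * Ham 0 (tcons i (tcons k K)) x else Ham q (tcons i K) x.
  case: q Ks {IH Kz step inv sw} => [//|q] Ks.
  rewrite Ham_cons; apply: eq_bigr => k _; congr (_ * _).
  apply: eq_Ham => s Hs; apply: Ks; rewrite /= ?Hs//.
  by apply/permPl; exact: (perm_catCA [:: _] [:: _] s).
rewrite !Ham_cons -sumrB.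
(* The changes inside the slices add up to q copies; the sign change of the outer spin at k = i
   supplies the last of the q + 1. *)
rewrite (eq_bigr (fun k => spin R x k * (Ham q (tcons k K) x - Ham q (tcons k K) (flip i x))
   + (if k == i then 2 * spin R x i * Ham q (tcons i K) x else 0))); last first.
  move=> k _; rewrite spin_flip; case: eqP => [->|_]; last by ring.
  by rewrite inv; ring.
rewrite big_split/= -big_mkcond big_pred1_eq.
rewrite (eq_bigr _ (fun k _ => sw k)) -mulr_sumr sumE -natr1 /=.
by case: q {IH Ks Kz step inv sw sumE} => [|q]; ring.
Qed.

Lemma mlocE p K x i : mloc p K x i = Ham p.-1 (tcons i K) x.
Proof. by []. Qed.

Lemma JlocE p K x i j : Jloc p K x i j = Ham p.-2 (tcons j (tcons i K)) x.
Proof. by rewrite mxE subn2. Qed.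

Variables (p : nat) (K : tensor R N).
Hypotheses (p2 : (2 <= p)%N) (Ks : tensor_symmetric p K) (Kz : tensor_zero_diag p K).

Lemma Ham_mloc x : Ham p K x = \sum_i spin R x i * mloc p K x i.
Proof. by case: p p2 => // q _; rewrite Ham_cons. Qed.

Lemma mloc_Jloc x i : mloc p K x i = \sum_j Jloc p K x i j * spin R x j.
Proof.
rewrite mlocE; case: p p2 => [//|[//|q]] _ /=.
by rewrite Ham_cons; apply: eq_bigr => j _; rewrite JlocE mulrC.
Qed.

Lemma Ham_flip_mloc x i : Ham p K x - Ham p K (flip i x) = 2 * p%:R * spin R x i * mloc p K x i.
Proof. exact: Ham_flip. Qed.

Lemma mloc_flip x i j :
  mloc p K x j - mloc p K (flip i x) j = 2 * (p.-1)%:R * spin R x i * Jloc p K x j i.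
Proof.
rewrite JlocE !mlocE; apply: Ham_flip.
  by apply: tcons_symmetric; rewrite prednK// ltnW.
by apply: tcons_zero_diag; rewrite prednK// ltnW.
Qed.

Lemma Jloc_diag x i : Jloc p K x i i = 0.
Proof. by rewrite JlocE Ham_tcons2//; case: p p2 Kz => [|[|]]. Qed.

Lemma mloc_flip_diag x i : mloc p K (flip i x) i = mloc p K x i.
Proof. by apply/esym/eqP; rewrite -subr_eq0 mloc_flip Jloc_diag mulr0. Qed.

End Forms.

(** * Operator norm: finiteness of the supremum and its basic inequalities *)

Section OpNorm.
Variables (R : realType) (N : nat).
Implicit Types (A : 'M[R]_N) (v : 'cV[R]_N).

Lemma vnorm_sqr v : vnorm v ^+ 2 = \sum_i v i 0 ^+ 2.
Proof. by rewrite sqr_sqrtr// sumr_ge0// => i _; rewrite sqr_ge0. Qed.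

Lemma vnorm_ge0 v : 0 <= vnorm v.
Proof. exact: sqrtr_ge0. Qed.

Lemma vnormZ (a : R) v : 0 <= a -> vnorm (a *: v) = a * vnorm v.
Proof.
move=> a0; rewrite -{2}(ger0_norm a0) -sqrtr_sqr -sqrtrM ?sqr_ge0// mulr_sumr.
by congr Num.sqrt; apply: eq_bigr => i _; rewrite mxE exprMn.
Qed.

(** Makes [sup] a genuine upper bound: entries of a unit vector are at most 1, so absolute row sums
    control the image. *)
Lemma vnorm_mul_bounded A :
  has_ubound [set vnorm (A *m v) | v in [set v : 'cV[R]_N | vnorm v = 1]].
Proof.
exists (Num.sqrt (\sum_i (\sum_j `|A i j|) ^+ 2)) => _ [v /= v1 <-].
apply: ler_wsqrtr; apply: ler_sum => i _; rewrite mxE.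
have vle j : `|v j 0| <= 1.
  rewrite -ler_sqr ?nnegrE// expr1n -(expr1n _ 2) -v1 vnorm_sqr real_normK ?num_real//.
  by rewrite (bigD1 j)//= lerDl sumr_ge0// => k _; rewrite sqr_ge0.
rewrite -[X in X <= _]real_normK ?num_real// ler_sqr ?nnegrE ?sumr_ge0//.
apply: (le_trans (ler_norm_sum _ _ _)); apply: ler_sum => j _.
by rewrite normrM ler_piMr.
Qed.

Lemma opnorm_ge0 A : 0 <= opnorm A.
Proof.
rewrite /opnorm; set E := [set _ | _ in _].
(* For N = 0 there is no unit vector and [sup] takes its default value 0. *)
have [->|/set0P[y Ey]] := eqVneq E set0; first by rewrite sup0.
apply: le_trans (ub_le_sup (vnorm_mul_bounded A) Ey).
by case: Ey => v _ <-; exact: vnorm_ge0.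
Qed.

Lemma vnorm_mulmx A v : vnorm (A *m v) <= opnorm A * vnorm v.
Proof.
have := vnorm_ge0 v; rewrite le_eqVlt => /predU1P[v0|v0].
  suff -> : v = 0.
    rewrite mulmx0 (_ : vnorm 0 = 0) ?mulr0// /vnorm big1 ?sqrtr0// => i _.
    by rewrite mxE expr0n.
  apply/matrixP => i j; rewrite ord1 mxE; apply/eqP; rewrite -sqrf_eq0.
  have /eqP := vnorm_sqr v; rewrite -v0 expr0n /= eq_sym psumr_eq0 => [|k _]; last exact: sqr_ge0.
  by move=> /allP/(_ i); rewrite mem_index_enum => /(_ isT).
rewrite -ler_pdivrMr// mulrC -vnormZ ?invr_ge0 ?vnorm_ge0// scalemxAr.
rewrite /opnorm; apply: (ub_le_sup (vnorm_mul_bounded A)).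
exists ((vnorm v)^-1 *: v) => //=.
by rewrite vnormZ ?invr_ge0 ?vnorm_ge0// mulVf// gt_eqF.
Qed.

Lemma opnorm_sum_sqr A (u : 'I_N -> R) :
  \sum_i (\sum_j A i j * u j) ^+ 2 <= opnorm A ^+ 2 * \sum_j u j ^+ 2.
Proof.
pose v : 'cV[R]_N := \col_j u j.
have -> : \sum_i (\sum_j A i j * u j) ^+ 2 = vnorm (A *m v) ^+ 2.
  rewrite vnorm_sqr; apply: eq_bigr => i _; rewrite mxE; congr (_ ^+ 2).
  by apply: eq_bigr => j _; rewrite mxE.
have -> : \sum_j u j ^+ 2 = vnorm v ^+ 2.
  by rewrite vnorm_sqr; apply: eq_bigr => j _; rewrite mxE.
by rewrite -exprMn ler_sqr ?nnegrE ?mulr_ge0 ?opnorm_ge0 ?vnorm_ge0// vnorm_mulmx.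
Qed.

Lemma opnorm_col_sqr A j : \sum_i A i j ^+ 2 <= opnorm A ^+ 2.
Proof.
have := opnorm_sum_sqr A (fun k => (k == j)%:R).
have -> : \sum_k (k == j)%:R ^+ 2 = 1 :> R.
  rewrite (bigD1 j)//= eqxx expr1n big1 ?addr0// => k /negbTE kj.
  by rewrite kj expr0n.
rewrite mulr1; congr (_ <= _); apply: eq_bigr => i _; congr (_ ^+ 2).
rewrite (bigD1 j)//= eqxx mulr1 big1 ?addr0// => k /negbTE kj.
by rewrite kj mulr0.
Qed.

End OpNorm.

(** * The Gibbs measure: normalisation, Markov and union bounds, lower tail of the Hamiltonian *)

Section Gibbs.
Variables (R : realType) (N p : nat) (K : tensor R N) (beta : R).
Implicit Types (x : config N) (A B : config N -> Prop) (f g : config N -> R).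

Lemma Zpart_gt0 : 0 < Zpart p K beta.
Proof.
rewrite mulr_gt0 ?invr_gt0 ?exprn_gt0// (bigD1 [ffun => true])//=.
by rewrite ltr_pwDl ?expR_gt0// sumr_ge0// => x _; rewrite expR_ge0.
Qed.

Lemma Pbeta_ge0 x : 0 <= Pbeta p K beta x.
Proof. by rewrite divr_ge0 ?expR_ge0// mulr_ge0 ?exprn_ge0// ltW// Zpart_gt0. Qed.

Lemma sum_Pbeta : \sum_x Pbeta p K beta x = 1.
Proof.
have := Zpart_gt0; rewrite /Pbeta -mulr_suml /Zpart mulrA divff ?mul1r; last first.
  by rewrite expf_neq0.
by move=> Z0; rewrite divff// gt_eqF//; move: Z0; rewrite pmulr_rgt0// invr_gt0 exprn_gt0.
Qed.

Lemma le_Expect f g : (forall x, f x <= g x) -> Expect p K beta f <= Expect p K beta g.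
Proof. by move=> fg; apply: ler_sum => x _; rewrite ler_wpM2l ?Pbeta_ge0. Qed.

Lemma ProbE A : Prob p K beta A = Expect p K beta (fun x => (`[< A x >])%:R).
Proof. by rewrite /Prob big_mkcond; apply: eq_bigr => x _; case: asbool; rewrite ?mulr1 ?mulr0. Qed.

Lemma markov_Expect f (a : R) : 0 < a -> (forall x, 0 <= f x) ->
  Prob p K beta (fun x => a < f x) <= Expect p K beta f / a.
Proof.
move=> a0 f0; rewrite ProbE ler_pdivlMr// mulr_suml.
apply: ler_sum => x _; rewrite -mulrA ler_wpM2l ?Pbeta_ge0//.
by case: asboolP => [/ltW|_]; rewrite ?mul1r ?mul0r.
Qed.

Lemma Prob_ge_compl3 (A B1 B2 B3 : config N -> Prop) :
  (forall x, ~ B1 x -> ~ B2 x -> ~ B3 x -> A x) ->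
  1 - (Prob p K beta B1 + Prob p K beta B2 + Prob p K beta B3) <= Prob p K beta A.
Proof.
move=> H; rewrite !ProbE -[X in X - _]sum_Pbeta -!big_split -sumrB /=.
apply: ler_sum => x _; rewrite -!mulrDr -{1}[Pbeta _ _ _ _]mulr1 -mulrBr.
rewrite ler_wpM2l ?Pbeta_ge0//.
have := H x; case: (asboolP (B1 x)) => H1; case: (asboolP (B2 x)) => H2;
  case: (asboolP (B3 x)) => H3; case: (asboolP (A x)) => H4 //= H5; try lra.
by case: H4; exact: H5.
Qed.

(** Each configuration in the event has mass at most e^(beta h) / (2^N Z); there are at most 2^N of
    them, and 1 / Z = e^(-F). *)
Lemma Prob_Ham_lt (h : R) : 0 < beta ->
  Prob p K beta (fun x => Ham p K x < h) <= expR (beta * h - Fpart p K beta).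
Proof.
move=> b0; rewrite expRB /Fpart lnK ?posrE ?Zpart_gt0//.
have Z0 := Zpart_gt0.
apply: le_trans (_ : \sum_(x : config N) expR (beta * h) / (2 ^+ N * Zpart p K beta) <= _).
  rewrite ProbE; apply: ler_sum => x _.
  have D0 : 0 < 2 ^+ N * Zpart p K beta by rewrite mulr_gt0// exprn_gt0.
  case: asboolP => [xh|_]; last by rewrite mulr0 divr_ge0 ?expR_ge0// ltW.
  by rewrite mulr1 ler_pM2r ?invr_gt0// ler_expR ler_pM2l// ltW.
rewrite sumr_const card_ffun card_bool card_ord -[X in X <= _]mulr_natl natrX.
by rewrite le_eqVlt; apply/orP; left; apply/eqP; field; rewrite gt_eqF//= expf_neq0.
Qed.

End Gibbs.

(** e^(2t) is the odds ratio of a spin with mean tanh t; it compares the weights of a configuration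
    and of its flip. *)
Lemma expR2_mul_1Btanh (R : realType) (t : R) : expR (2 * t) * (1 - tanh t) = 1 + tanh t.
Proof.
have Ha := lt0r_neq0 (expRDN_gt0 t).
have -> : expR (2 * t) = expR t * expR t by rewrite -expRD; congr expR; ring.
have E : expR (- t) = (expR t)^-1 by rewrite expRN.
have e0 := lt0r_neq0 (expR_gt0 t).
by rewrite /tanh E in Ha *; field; rewrite -?E; apply/andP.
Qed.

(** * Second moment of the score at the true parameter *)

Section SecondMoment.
Variables (R : realType) (N p : nat) (K : tensor R N) (beta : R).
Hypotheses (p2 : (2 <= p)%N) (Ks : tensor_symmetric p K) (Kz : tensor_zero_diag p K).
Hypothesis (beta0 : 0 < beta).
Implicit Types (x : config N) (i j : 'I_N).

Local Notation m := (mloc p K).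
Local Notation s := (spin R).
Local Notation L x := (opnorm (Jloc p K x)).
Let c := p%:R * beta.
Let a x i := tanh (c * m x i).

(** Derivative in [b] of the log pseudo-likelihood, divided by p. *)
Definition score (b : R) x := \sum_i m x i * (s x i - tanh (p%:R * b * m x i)).

Lemma scoreE b x : score b x = Ham p K x - \sum_i m x i * tanh (p%:R * b * m x i).
Proof. by rewrite (Ham_mloc K p2) -sumrB; apply: eq_bigr => i _; rewrite mulrBr [s x i * _]mulrC. Qed.

Let c_gt0 : 0 < c.
Proof. by rewrite mulr_gt0// ltr0n ltnW. Qed.

(** Detailed balance for resampling spin [i]: half of 1 - x_i a_i is the conditional probability of
    reversing it, half of 1 + x_i a_i that of keeping it. *)
Let weight_flip i x :
  Pbeta p K beta (flip i x) * (1 + s x i * a x i) = Pbeta p K beta x * (1 - s x i * a x i).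
Proof.
rewrite /Pbeta ![_ / _ * _]mulrAC; congr (_ / _).
have -> : s x i * a x i = tanh (s x i * (c * m x i)).
  by rewrite /a /spin; case: (x i); rewrite ?mul1r// !mulN1r tanhN.
have -> : beta * Ham p K x =
    beta * Ham p K (flip i x) + 2 * (s x i * (c * m x i)).
  have -> : Ham p K x = Ham p K (flip i x) + 2 * p%:R * s x i * m x i.
    by rewrite -(Ham_flip_mloc Ks Kz); ring.
  by rewrite /c; ring.
by rewrite expRD -[in RHS]mulrA expR2_mul_1Btanh.
Qed.

(* The conditional law of x_i given the other spins has mean a x i; symmetrising
   under the flip of x_i turns the centred spin into a discrete derivative. *)
Lemma Expect_centred_spin i (f : config N -> R) :
  Expect p K beta (fun x => (s x i - tanh (p%:R * beta * m x i)) * f x) =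
  2^-1 * Expect p K beta (fun x => (1 - s x i * tanh (p%:R * beta * m x i)) * s x i *
     (f x - f (flip i x))).
Proof.
rewrite /Expect -/c.
pose V x := Pbeta p K beta x * (1 - s x i * a x i).
have Vf x : V (flip i x) = V x.
  by rewrite /V spin_flip eqxx /a (mloc_flip_diag p2 Ks Kz) mulNr opprK weight_flip.
have -> : \sum_x Pbeta p K beta x * ((s x i - tanh (c * m x i)) * f x) =
   \sum_x V x * s x i * f x.
  apply: eq_bigr => x _; rewrite /V -/(a x i).
  rewrite (_ : s x i - a x i = (1 - s x i * a x i) * s x i + a x i * (s x i * s x i - 1)); last by ring.
  by rewrite spin_sqr subrr mulr0 addr0; ring.
(* [V] is flip-invariant, so reindexing by the flip only reverses the sign of the spin. *)
have E : \sum_x V x * s x i * f (flip i x) = - \sum_x V x * s x i * f x.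
  rewrite (reindex_inj (inv_inj (@flipK N i)))/= -sumrN; apply: eq_bigr => x _.
  by rewrite flipK Vf spin_flip eqxx; ring.
have -> : \sum_x Pbeta p K beta x *
   ((1 - s x i * tanh (c * m x i)) * s x i * (f x - f (flip i x))) =
   \sum_x V x * s x i * f x - \sum_x V x * s x i * f (flip i x).
  by rewrite -sumrB; apply: eq_bigr => x _; rewrite /V /a; ring.
by rewrite E; field.
Qed.

(** The vector of size O(|m_i|) in the bilinear form of J(x). *)
Let u x i := m x i * (1 - s x i * a x i).

Let norm_u x i : `|u x i| <= 2 * `|m x i|.
Proof.
rewrite normrM mulrC ler_wpM2r// (le_trans (ler_normB _ _))//.
rewrite normr1 normrM norm_spin mul1r (_ : 2 = 1 + 1 :> R); last by ring.
by rewrite lerD2l ltW// norm_tanh_lt1.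
Qed.

Let sum_m_sqr x : \sum_i m x i ^+ 2 <= L x ^+ 2 * N%:R.
Proof.
have := opnorm_sum_sqr (Jloc p K x) (s x).
rewrite [X in _ <= _ * X](_ : _ = N%:R).
  by congr (_ <= _); apply: eq_bigr => i _; rewrite (mloc_Jloc K p2).
rewrite (eq_bigr (fun=> 1)) => [|i _]; last by rewrite expr2 spin_sqr.
by rewrite sumr_const card_ord.
Qed.

(** The terms come from the change of H, the linear Taylor part and the remainder. There 16 = 4 *
    2^2, and the factor 1/2 absorbs the 2 in |u_i| <= 2 |m_i|. *)
Let score_diff x i : 2^-1 * (u x i * s x i * (score beta x - score beta (flip i x))) <=
  2 * p%:R * m x i ^+ 2
  - p.-1%:R * \sum_j dxtanh (c * m x j) * (Jloc p K x j i * u x i)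
  + 16 * c * p.-1%:R ^+ 2 * (`|m x i| * \sum_j Jloc p K x j i ^+ 2).
Proof.
pose phi v := v * tanh (c * v).
pose rem j := phi (m (flip i x) j) - phi (m x j)
   - dxtanh (c * m x j) * (m (flip i x) j - m x j).
have dm j : m (flip i x) j - m x j = - (2 * p.-1%:R * s x i * Jloc p K x j i).
  by rewrite -(mloc_flip p2 Ks Kz) opprB.
have remP j : `|rem j| <= 16 * c * p.-1%:R ^+ 2 * Jloc p K x j i ^+ 2.
  apply: (le_trans (mul_tanh_scaled_taylor _ _ c_gt0)); rewrite dm.
  rewrite le_eqVlt; apply/orP; left; apply/eqP.
  transitivity (16 * c * p.-1%:R ^+ 2 * Jloc p K x j i ^+ 2 * (s x i * s x i)); first by ring.
  by rewrite spin_sqr mulr1.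
have -> : score beta x - score beta (flip i x) =
   2 * p%:R * s x i * m x i + \sum_j (phi (m (flip i x) j) - phi (m x j)).
  by rewrite !scoreE -/c sumrB /phi -(Ham_flip_mloc Ks Kz); ring.
have -> : \sum_j (phi (m (flip i x) j) - phi (m x j)) =
   - (2 * p.-1%:R * s x i) * (\sum_j dxtanh (c * m x j) * Jloc p K x j i) + \sum_j rem j.
  rewrite mulr_sumr -big_split; apply: eq_bigr => j _ /=.
  by rewrite /rem dm; ring.
have -> : \sum_j dxtanh (c * m x j) * (Jloc p K x j i * u x i) =
   u x i * \sum_j dxtanh (c * m x j) * Jloc p K x j i.
  by rewrite mulr_sumr; apply: eq_bigr => j _; ring.
set S := \sum_j dxtanh _ * _.
have -> : 2^-1 * (u x i * s x i * (2 * p%:R * s x i * m x i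
     + (- (2 * p.-1%:R * s x i) * S + \sum_j rem j))) =
   p%:R * (u x i * m x i) * (s x i * s x i)
   - p.-1%:R * (u x i * S) * (s x i * s x i) + 2^-1 * (u x i * (s x i * \sum_j rem j)).
  by field.
rewrite !spin_sqr !mulr1.
have um : u x i * m x i <= 2 * m x i ^+ 2.
  rewrite (le_trans (ler_norm _))// normrM -[X in _ <= 2 * X]real_normK ?num_real//.
  by rewrite expr2 mulrA ler_wpM2r.
apply: lerD.
  by rewrite lerD2r (mulrC 2) -[_ * 2 * _]mulrA ler_wpM2l.
move: (u x i) (norm_u x i) => U HU.
rewrite (le_trans (ler_norm _))// !normrM norm_spin mul1r ger0_norm ?invr_ge0//.
rewrite mulrA.
apply: le_trans (_ : `|m x i| * `|\sum_j rem j| <= _).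
  by apply: ler_wpM2r => //; lra.
rewrite mulrCA ler_wpM2l// mulr_sumr (le_trans (ler_norm_sum _ _ _))//.
by apply: ler_sum => j _.
Qed.

(** Sum of the three contributions 2p, 2(p-1) <= 2p and 16 c (p-1)^2. *)
Definition score_const := 4 * p%:R + 16 * c * p.-1%:R ^+ 2.

Lemma score_const_gt0 : 0 < score_const.
Proof.
by rewrite ltr_pwDl ?mulr_gt0 ?ltr0n// 1?ltnW// mulr_ge0 ?sqr_ge0// mulr_ge0// ltW.
Qed.

Lemma Expect_score_sqr :
  Expect p K beta (fun x => score beta x ^+ 2) <=
  score_const * N%:R * (1 + Expect p K beta (fun x => L x ^+ 4)).
Proof.
have -> : Expect p K beta (fun x => score beta x ^+ 2) =
  Expect p K beta (fun x => \sum_i 2^-1 * (u x i * s x i * (score beta x - score beta (flip i x)))).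
  (* One factor of the score is expanded into centred spins; as m_i does not depend on x_i, the flip
     differences only the other factor. *)
  transitivity (\sum_i Expect p K beta (fun x =>
     (s x i - tanh (p%:R * beta * m x i)) * (m x i * score beta x))).
    rewrite /Expect exchange_big; apply: eq_bigr => x _ /=.
    rewrite -mulr_sumr; congr (_ * _); rewrite expr2 {1}/score mulr_suml.
    by apply: eq_bigr => i _; ring.
  under eq_bigr do rewrite Expect_centred_spin mulr_sumr.
  rewrite /Expect exchange_big; apply: eq_bigr => x _ /=.
  rewrite mulr_sumr; apply: eq_bigr => i _.
  by rewrite (mloc_flip_diag p2 Ks Kz) /u /a /c; ring.
have -> : score_const * N%:R * (1 + Expect p K beta (fun x => L x ^+ 4)) =
   Expect p K beta (fun x => score_const * N%:R * (1 + L x ^+ 4)).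
  transitivity (score_const * N%:R * (\sum_x Pbeta p K beta x +
    Expect p K beta (fun x => L x ^+ 4))); first by rewrite sum_Pbeta.
  rewrite /Expect -big_split mulr_sumr.
  by apply: eq_bigr => x _ /=; ring.
apply: le_Expect => x.
apply: le_trans; first by apply: ler_sum => i _; exact: score_diff.
rewrite big_split sumrB/= -!mulr_sumr.
set l := L x.
have l0 : 0 <= l by exact: opnorm_ge0.
have n0 : 0 <= N%:R :> R by [].
have M := sum_m_sqr x; rewrite -/l in M.
have l2 : l ^+ 2 <= 1 + l ^+ 4.
  rewrite -subr_ge0 (_ : _ - _ = (l ^+ 2 - 2^-1) ^+ 2 + 3 / 4); last by field.
  by rewrite addr_ge0 ?sqr_ge0// divr_ge0.
have M1 : \sum_i m x i ^+ 2 <= N%:R * (1 + l ^+ 4).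
  by rewrite (le_trans M)// mulrC ler_wpM2l.
(* With y = (J u)_j and |[dxtanh]| <= 2, use -d y <= (4 + y^2) / 2, then |J u|^2 <= l^2 |u|^2 <= 4
   l^4 N. *)
have B1 : - (\sum_i \sum_j dxtanh (c * m x j) * (Jloc p K x j i * u x i)) <=
   2 * (N%:R * (1 + l ^+ 4)).
  rewrite exchange_big -sumrN /=.
  apply: le_trans (_ : \sum_j 2^-1 * (4 + (\sum_i Jloc p K x j i * u x i) ^+ 2) <= _).
    apply: ler_sum => j _; rewrite -mulr_sumr.
    set y := \sum_i _.
    have d2 : dxtanh (c * m x j) ^+ 2 <= 4.
      rewrite -real_normK ?num_real// (_ : 4 = 2 ^+ 2 :> R); last by ring.
      by rewrite ler_sqr ?nnegrE// norm_dxtanh.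
    have := sqr_ge0 (dxtanh (c * m x j) + y); nra.
  rewrite -mulr_sumr big_split sumr_const card_ord /=.
  have U : \sum_i u x i ^+ 2 <= 4 * (l ^+ 2 * N%:R).
    apply: (@le_trans _ _ (4 * \sum_i m x i ^+ 2)); last by rewrite ler_wpM2l.
    rewrite mulr_sumr; apply: ler_sum => i _.
    rewrite -real_normK ?num_real// -[m x i ^+ 2]real_normK ?num_real//.
    rewrite (_ : 4 * _ = (2 * `|m x i|) ^+ 2); last by ring.
    by rewrite ler_sqr ?nnegrE ?mulr_ge0.
  have O := opnorm_sum_sqr (Jloc p K x) (u x); rewrite -/l in O.
  have {}O := le_trans O (ler_wpM2l (sqr_ge0 l) U).
  rewrite (_ : l ^+ 2 * (4 * (l ^+ 2 * N%:R)) = 4 * (N%:R * l ^+ 4)) in O; last by ring.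
  rewrite -[4 *+ N]mulr_natr; lra.
(* Column norms are at most l, and |m_i| l^2 <= (m_i^2 + l^4) / 2. *)
have B2 : \sum_i `|m x i| * (\sum_j Jloc p K x j i ^+ 2) <= N%:R * (1 + l ^+ 4).
  apply: le_trans (_ : \sum_i 2^-1 * (m x i ^+ 2 + l ^+ 4) <= _).
    apply: ler_sum => i _.
    apply: (@le_trans _ _ (`|m x i| * l ^+ 2)); first by rewrite ler_wpM2l// opnorm_col_sqr.
    rewrite -[m x i ^+ 2]real_normK ?num_real//.
    have := sqr_ge0 (`|m x i| - l ^+ 2).
    rewrite (_ : (_ - _) ^+ 2 = `|m x i| ^+ 2 + l ^+ 4 - 2 * (`|m x i| * l ^+ 2)); last by ring.
    lra.
  rewrite -mulr_sumr big_split sumr_const card_ord /= -[_ *+ N]mulr_natl.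
  lra.
have q0 : 0 <= p.-1%:R :> R by [].
have pq : p%:R = 1 + p.-1%:R :> R by rewrite -[in LHS](ltn_predK p2) -natr1 addrC.
rewrite /score_const.
set T := N%:R * (1 + l ^+ 4) in M1 B1 B2 *.
have T0 : 0 <= T by rewrite mulr_ge0// addr_ge0// exprn_ge0.
have C1 := ler_wpM2l (mulr_ge0 (ler0n R 2) (ler0n R p)) M1.
have C2 := ler_wpM2l q0 B1.
have k0 : 0 <= 16 * c * p.-1%:R ^+ 2.
  by rewrite mulr_ge0 ?sqr_ge0// mulr_ge0// ltW.
have C3 := ler_wpM2l k0 B2.
rewrite mulrN in C2.
rewrite [X in _ <= X](_ : _ = 4 * p%:R * T + 16 * c * p.-1%:R ^+ 2 * T); last by rewrite /T; ring.
have C4 : p.-1%:R * (2 * T) <= 2 * p%:R * T.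
  rewrite pq; nra.
lra.
Qed.

End SecondMoment.

(** * Slope of the estimating function and location of its root, for a fixed sample *)

Section Deterministic.
Variables (R : realType) (N p : nat) (K : tensor R N) (x : config N).
Hypotheses (p2 : (2 <= p)%N) (N0 : (0 < N)%N).

Local Notation m := (mloc p K x).
Local Notation L := (opnorm (Jloc p K x)).

Definition pl_fun (b : R) := \sum_i m i * tanh (p%:R * b * m i).

Lemma pl_fun0 : pl_fun 0 = 0.
Proof. by rewrite /pl_fun big1// => i _; rewrite mulr0 mul0r tanh0 mulr0. Qed.

Lemma continuous_pl_fun (A : set R) : {within A, continuous pl_fun}.
Proof.
apply: continuous_subspaceT => b; apply: differentiable_continuous.
apply/derivable1_diffP; rewrite /pl_fun.
have -> : (fun b : R => \sum_i m i * tanh (p%:R * b * m i)) =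
  \sum_i (fun b : R => m i * tanh (p%:R * b * m i)).
  by apply/funext => c; rewrite fct_sumE.
apply: derivable_sum => i.
apply: derivableM; first exact: derivable_cst.
have Hd : is_derive b 1 (fun b : R => p%:R * b * m i) (p%:R * m i).
  by apply: is_derive_eq; rewrite /GRing.scale /=; ring.
have Ht := is_derive_tanh (p%:R * b * m i).
by case: (is_derive1_comp (f := @tanh R) (g := fun b : R => p%:R * b * m i) Ht Hd).
Qed.

(* Splitting |m| <= m^2 1{|m| <= k} / e + e / 4 + m^2 / k with k = 4 l / e. *)
Lemma truncated_mloc_sqr_ge (e l : R) : 0 < e -> 0 < l ->
  e * N%:R <= Ham p K x -> L ^+ 2 <= l ->
  e ^+ 2 / 2 * N%:R <= \sum_(i | `|m i| <= 4 * l / e) m i ^+ 2.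
Proof.
move=> e0 l0 eH Ll.
have k0 : 0 < 4 * l / e by rewrite divr_gt0// mulr_gt0.
set k := 4 * l / e in k0 *.
have M : \sum_i m i ^+ 2 <= l * N%:R.
  have := opnorm_sum_sqr (Jloc p K x) (spin R x).
  rewrite [X in _ <= _ * X](_ : _ = N%:R); last first.
    rewrite (eq_bigr (fun=> 1)) => [|i _]; last by rewrite expr2 spin_sqr.
    by rewrite sumr_const card_ord.
  rewrite (eq_bigr (fun i => m i ^+ 2)) => [|i _]; last by rewrite (mloc_Jloc K p2).
  by move/le_trans; apply; rewrite ler_wpM2r.
have H : e * N%:R <= \sum_i ((if `|m i| <= k then m i ^+ 2 else 0) / e + e / 4 + m i ^+ 2 / k).
  apply: (le_trans eH); rewrite (Ham_mloc K p2); apply: ler_sum => i _.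
  rewrite (le_trans (ler_norm _))// normrM norm_spin mul1r.
  rewrite -[m i ^+ 2]real_normK ?num_real//.
  set t := `|m i|; have t0 : 0 <= t by exact: normr_ge0.
  have q0 : 0 <= t ^+ 2 / k by rewrite divr_ge0 ?sqr_ge0// ltW.
  case: (leP t k) => tk.
    apply: ler_wpDr => //.
    rewrite -subr_ge0 (_ : _ - _ = (t - e / 2) ^+ 2 / e); last by field; rewrite gt_eqF.
    by rewrite divr_ge0 ?sqr_ge0// ltW.
  rewrite mul0r add0r; apply: ler_wpDl; first by rewrite divr_ge0// ltW.
  by rewrite ler_pdivlMr// expr2 ler_wpM2l// ltW.
rewrite !big_split sumr_const card_ord /= -!mulr_suml -big_mkcond in H.
set Q := \sum_(i | _) _ in H *.
(* This k makes the tail cost e N / 4; with the constant term e N / 4, half of e N is left for the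
   truncated sum. *)
have kE : l * N%:R / k = e * N%:R / 4 by rewrite /k; field; rewrite !gt_eqF.
have M' : (\sum_i m i ^+ 2) / k <= e * N%:R / 4 by rewrite -kE ler_wpM2r// invr_ge0 ltW.
rewrite -[_ *+ N]mulr_natr in H.
have HQ : e * N%:R / 2 <= Q / e by lra.
rewrite (_ : _ * _ = e * N%:R / 2 * e); last by field.
by rewrite -ler_pdivlMr.
Qed.

(** Product of p E / 2, the bound of [tanh_strong_mono] at |m_i| = k = 4 l / e, and of the mass e^2
    / 2 in [truncated_mloc_sqr_ge]. *)
Definition pl_slope (e l B : R) := p%:R * expR (- (2 * (p%:R * B * (4 * l / e)))) * e ^+ 2 / 4.

Lemma pl_slope_gt0 e l B : 0 < e -> 0 < pl_slope e l B.
Proof. by move=> e0; rewrite !mulr_gt0 ?expR_gt0 ?exprn_gt0 ?invr_gt0// ltr0n ltnW. Qed.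

(** Every summand is nondecreasing, so the indices with |m_i| > k are dropped and only the truncated
    mass is used. *)
Lemma pl_fun_strong_mono (e l B a b : R) : 0 < e -> 0 < l ->
  e * N%:R <= Ham p K x -> L ^+ 2 <= l -> 0 <= a -> a <= b -> b <= B ->
  pl_slope e l B * N%:R * (b - a) <= pl_fun b - pl_fun a.
Proof.
move=> e0 l0 eH Ll a0 ab bB.
have T := truncated_mloc_sqr_ge e0 l0 eH Ll.
set k := 4 * l / e in T *.
have k0 : 0 < k by rewrite divr_gt0// mulr_gt0.
pose E := expR (- (2 * (p%:R * B * k))).
have b0 := le_trans a0 ab.
have D i : (if `|m i| <= k then m i ^+ 2 else 0) * (p%:R * (b - a) * E / 2) <=
   m i * tanh (p%:R * b * m i) - m i * tanh (p%:R * a * m i).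
  have pab : 0 <= p%:R * a <= p%:R * b by rewrite mulr_ge0// ler_wpM2l.
  rewrite -mulrBr; apply: le_trans (tanh_strong_mono (m i) pab).
  have c0 : 0 <= p%:R * (b - a) by rewrite mulr_ge0// subr_ge0.
  rewrite -mulrBr.
  case: (leP `|m i| k) => mk; last first.
    rewrite mul0r divr_ge0//.
    by apply: mulr_ge0 (expR_ge0 _); exact: mulr_ge0 (sqr_ge0 _).
  rewrite mulrA ler_wpM2r// ?invr_ge0// mulrCA -mulrA ler_wpM2l// ler_wpM2l ?sqr_ge0//.
  rewrite /E ler_expR lerN2 ler_wpM2l//.
  by apply: ler_pM => //; [exact: mulr_ge0 | exact: ler_wpM2l].
rewrite /pl_fun -sumrB.
apply: le_trans (ler_sum _ (fun i _ => D i)).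
rewrite -mulr_suml -big_mkcond.
have c0 : 0 <= p%:R * (b - a) * E / 2 by rewrite divr_ge0// !mulr_ge0 ?expR_ge0// subr_ge0.
apply: le_trans (ler_wpM2r c0 T).
by rewrite le_eqVlt; apply/orP; left; apply/eqP; rewrite /pl_slope -/k -/E; field.
Qed.

(** A small score keeps H below [pl_fun (beta + 1)], so the intermediate value theorem gives a root.
    Strong monotonicity makes it the least nonnegative one and bounds its distance to [beta] by
    |score| / (g N). *)
Lemma mple_eq_of_score (e l beta V : R) : 0 < e -> 0 < l -> 0 < beta ->
  e * N%:R <= Ham p K x -> L ^+ 2 <= l ->
  score p K beta x ^+ 2 <= V * N%:R -> V <= pl_slope e l (beta + 1) ^+ 2 * N%:R ->
  exists b : R, mple p K x = b%:E /\
    Num.sqrt N%:R * `|b - beta| <= V / pl_slope e l (beta + 1) ^+ 2 + 1.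
Proof.
move=> e0 l0 beta0 eH Ll SV Vn.
set g := pl_slope e l (beta + 1) in Vn *.
have g0 : 0 < g by exact: pl_slope_gt0.
have n0 : 0 < N%:R :> R by rewrite ltr0n.
have gn0 : 0 < g * N%:R by rewrite mulr_gt0.
have mono a b : 0 <= a -> a <= b -> b <= beta + 1 ->
    g * N%:R * (b - a) <= pl_fun b - pl_fun a.
  exact: pl_fun_strong_mono.
have scE : score p K beta x = Ham p K x - pl_fun beta by rewrite (scoreE K p2).
have b1 : beta <= beta + 1 by rewrite lerDl.
have Hle : Ham p K x <= pl_fun (beta + 1).
  have := mono _ _ (ltW beta0) b1 (lexx _).
  have S : score p K beta x <= g * N%:R.
    rewrite (le_trans (ler_norm _))// -ler_sqr ?nnegrE ?(ltW gn0)// real_normK ?num_real//.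
    by rewrite (le_trans SV)// exprMn (expr2 N%:R) mulrA ler_wpM2r// ltW.
  by rewrite scE in S; lra.
have H0 : pl_fun 0 <= Ham p K x by rewrite pl_fun0 (le_trans _ eH)// mulr_ge0// ltW.
have B0 : 0 <= beta + 1 by rewrite addr_ge0// ltW.
have [|b] := IVT (v := Ham p K x) B0 (@continuous_pl_fun _).
  by rewrite ge_min H0 le_max Hle orbT.
rewrite in_itv /= => /andP[b0 bB] bH.
exists b; split.
  apply/le_anti/andP; split.
    by apply: ereal_inf_lbound; exists b => //; split; rewrite // -bH.
  apply/ereal_infP => _ [b' [b'0 b'H] <-]; rewrite lee_fin leNgt; apply/negP => b'b.
  have := mono _ _ b'0 (ltW b'b) bB.
  rewrite bH b'H -/(pl_fun b') subrr.
  by apply/negP; rewrite -ltNge mulr_gt0// subr_gt0.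
have D : g * N%:R * `|b - beta| <= `|score p K beta x|.
  rewrite scE -bH; have [bb|/ltW bb] := leP beta b.
    rewrite (ger0_norm (_ : 0 <= b - beta)) ?subr_ge0//.
    by rewrite (le_trans (mono _ _ (ltW beta0) bb bB))// ler_norm.
  rewrite distrC (ger0_norm (_ : 0 <= beta - b)) ?subr_ge0// distrC.
  by rewrite (le_trans (mono _ _ b0 bb b1))// ler_norm.
set t := Num.sqrt _ * _.
have t0 : 0 <= t by rewrite mulr_ge0// sqrtr_ge0.
have t2 : t ^+ 2 <= V / g ^+ 2.
  rewrite exprMn sqr_sqrtr ?(ltW n0)// ler_pdivlMr ?exprn_gt0//.
  rewrite -(ler_pM2r n0); apply: le_trans SV.
  rewrite -[X in _ <= X]real_normK ?num_real//.
  apply: le_trans (_ : (g * N%:R * `|b - beta|) ^+ 2 <= _).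
    by rewrite le_eqVlt; apply/orP; left; apply/eqP; ring.
  by rewrite ler_sqr ?nnegrE// mulr_ge0// ltW.
(* t <= t^2 + 1 replaces a square root by the additive 1 in the bound. *)
have := sqr_ge0 (t - 1); nra.
Qed.

End Deterministic.

(** * From a positive lower limit to an eventual lower bound *)

Section Limits.
Variable R : realType.

(** The lower limit is a supremum of tail infima, so one of them is positive; it is finite because
    it lies below a real term. *)
Lemma limn_einf_gt0 (v : nat -> R) : (0 < limn_einf (EFin \o v))%E ->
  exists2 r : R, 0 < r & \forall n \near \oo, r <= v n.
Proof.
rewrite limn_einf_lim.
have /cvg_lim -> // := ereal_nondecreasing_cvgn (nondecreasing_einfs (EFin \o v)).
move=> /ereal_sup_gt[_ [n _ <-]]; rewrite /einfs /=.
set e := ereal_inf _ => e0.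
have eP k : (n <= k)%N -> (e <= (v k)%:E)%E by move=> nk; apply: ereal_inf_lbound; exists k.
have ef : e \is a fin_num.
  by rewrite ge0_fin_numE ?(ltW e0)// (le_lt_trans (eP n (leqnn n)))// ltry.
exists (fine e); first by rewrite fine_gt0// e0 ltey_eq ef.
by exists n => // k /= nk; rewrite -lee_fin fineK// eP.
Qed.

End Limits.

(** * Choice of constants and combination of three bad events *)

Theorem mainTheorem13 (R : realType) (p : nat) (beta : R)
  (J : forall N : nat, tensor R N) :
  (2 <= p)%N -> 0 < beta ->
  (forall N, (1 <= N)%N -> tensor_symmetric p (J N) /\ tensor_zero_diag p (J N)) ->
  (exists C : R, forall N, (1 <= N)%N ->
     Expect p (J N) beta (fun z => opnorm (Jloc p (J N) z) ^+ 4) <= C) ->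
  (0 < limn_einf (fun N => ((Fpart p (J N) beta / N%:R)%:E)))%E ->
  forall delta : R, 0 < delta ->
    exists M : R, 0 < M /\
      \forall N \near \oo,
        1 - delta < Prob p (J N) beta
          (fun x => exists b : R, mple p (J N) x = b%:E /\
                     Num.sqrt N%:R * `|b - beta| <= M).
Proof.
move=> p2 beta0 HJ [C0 HC] HF delta d0.
have [r r0 rF] := limn_einf_gt0 HF.
pose C := `|C0| + 1.
have C1 : 0 < C by rewrite ltr_wpDl.
have HC' N : (1 <= N)%N -> Expect p (J N) beta (fun z => opnorm (Jloc p (J N) z) ^+ 4) <= C.
  by move=> /HC/le_trans; apply; rewrite (le_trans (ler_norm _))// lerDl.
(* Makes beta e N equal to r N / 2, half of the lower bound r N on F_N. *)
pose e := r / (2 * beta).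
have e0 : 0 < e by rewrite divr_gt0// mulr_gt0.
(* [a] and, below, [V] are the Markov thresholds giving probability at most delta / 4 each. *)
pose a := 4 * C / delta.
have a0 : 0 < a by rewrite divr_gt0// mulr_gt0.
pose k := score_const p beta.
have k0 : 0 < k by exact: score_const_gt0.
pose V := 4 * k * (1 + C) / delta.
have V0 : 0 < V by rewrite divr_gt0// !mulr_gt0// ltr_wpDl// ltW.
(* L^4 <= a implies L^2 <= 1 + a, whence the argument 1 + a. *)
pose g := pl_slope p e (1 + a) (beta + 1).
have g0 : 0 < g by exact: pl_slope_gt0.
exists (V / g ^+ 2 + 1); split; first by rewrite ltr_wpDl// divr_ge0 ?sqr_ge0// ltW.
have N1 : \forall N \near \oo, (1 <= N)%N by exact: nbhs_infty_ge.
have N2 : \forall N \near \oo, V / g ^+ 2 <= N%:R by exact: nbhs_infty_ger.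
(* Ensures r N / 2 >= 4 / delta, so that e^y >= 1 + y brings the lower tail of H under delta / 4. *)
have N3 : \forall N \near \oo, 8 / (r * delta) <= N%:R :> R by exact: nbhs_infty_ger.
near=> N.
have N0 : (1 <= N)%N by near: N.
have NV : V / g ^+ 2 <= N%:R by near: N.
have Nr : 8 / (r * delta) <= N%:R by near: N.
have rFN : r <= Fpart p (J N) beta / N%:R by near: N.
have n0 : 0 < N%:R :> R by rewrite ltr0n.
have [Ks Kz] := HJ N N0.
pose B1 x := Ham p (J N) x < e * N%:R.
pose B2 x := a < opnorm (Jloc p (J N) x) ^+ 4.
pose B3 x := V * N%:R < score p (J N) beta x ^+ 2.
have PB1 : Prob p (J N) beta B1 <= delta / 4.
  apply: (le_trans (Prob_Ham_lt _ _ _ beta0)).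
  apply: (@le_trans _ _ (expR (- (r * N%:R / 2)))).
    rewrite ler_expR; rewrite ler_pdivlMr// in rFN.
    rewrite (_ : beta * (e * N%:R) = r * N%:R / 2); first by lra.
    by rewrite /e; field; rewrite gt_eqF.
  set y := r * N%:R / 2.
  have y4 : 4 / delta <= y.
    rewrite /y ler_pdivlMr// -ler_pdivrMl//.
    by rewrite (le_trans _ Nr)// le_eqVlt; apply/orP; left; apply/eqP; field; rewrite !gt_eqF.
  rewrite expRN -[delta / 4]invrK invf_div lef_pV2 ?posrE ?expR_gt0 ?divr_gt0//.
  by rewrite (le_trans y4)// (le_trans _ (expR_ge1Dx _))// lerDr.
have PB2 : Prob p (J N) beta B2 <= delta / 4.
  apply: (le_trans (markov_Expect p (J N) beta a0 _)) => [x|].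
    by rewrite exprn_ge0// opnorm_ge0.
  rewrite ler_pdivrMr// (le_trans (HC' N N0))// /a.
  by rewrite le_eqVlt; apply/orP; left; apply/eqP; field; rewrite gt_eqF.
have PB3 : Prob p (J N) beta B3 <= delta / 4.
  apply: (le_trans (markov_Expect p (J N) beta (mulr_gt0 V0 n0) _)) => [x|]; first exact: sqr_ge0.
  rewrite ler_pdivrMr; last exact: mulr_gt0.
  apply: (le_trans (Expect_score_sqr p2 Ks Kz beta0)).
  rewrite (_ : delta / 4 * _ = k * N%:R * (1 + C)).
    by rewrite ler_wpM2l ?lerD2l ?HC'// mulr_ge0// ltW.
  by rewrite /V; field; rewrite gt_eqF.
apply: lt_le_trans (@Prob_ge_compl3 _ _ p (J N) beta _ B1 B2 B3 _); first lra.
move=> x /negP; rewrite -leNgt => b1 /negP; rewrite -leNgt => b2 /negP; rewrite -leNgt => b3.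
apply: mple_eq_of_score b1 _ b3 _ => //.
- by rewrite ltr_wpDr// ltW.
- set l := opnorm _ in b2 *.
  have := sqr_ge0 (l ^+ 2 - 2^-1).
  rewrite (_ : (_ - _) ^+ 2 = l ^+ 4 - l ^+ 2 + 4^-1); last by field.
  lra.
- by rewrite mulrC -ler_pdivrMr ?exprn_gt0.
Unshelve. all: by end_near.
Qed.
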